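(* Let $G$ be a finite simple undirected graph on $n$ vertices and let $M$ be the multipartite graph on which the clean-factor series of $G$ terminates. Let $k$ and $c$ be integers such that every vertex of $G$ belongs to at most $k$ maximal cliques of $G$ and every maximal clique of $G$ contains at most $c$ vertices. Then $$|V(M)|\le \min\left(k\,2^c\,c!\,,\ 2^k\,k!+1\right)\times n.$$
   Context: All graphs are finite, undirected and simple. A $p$-partite graph $G=(V_0,\ldots,V_{p-1},E)$ is a graph together with an ordered partition $(V_0,\ldots,V_{p-1})$ of its vertex set into $p$ non-empty parts (levels) such that every edge joins vertices in different parts. $N(x)$ is the neighbourhood of $x$ and $N_i(x)=N(x)\cap V_i$. Factorisation. Given a $p$-partite graph $G=(V_0,\ldots,V_{p-1},E)$ with $p\ge 2$ and a set $V'_p$ of subsets of $V(G)$, the factorisation of $G$ with respect to $V'_p$ is the graph $G'=(V_0,\ldots,V_p,E\cup E_+)$, where the new level $V_p$ is the set of inclusion-maximal elements of $V'_p$ and $E_+=\{Xy \mid X\in V_p,\ y\in X\}$. It is called effective if $V_p\neq\emptyset$. The set $V^+_p$. For a $p$-partite graph, $V^+_p$ is the set of all sets $\{x_1,\ldots,x_l\}\cup\bigcap_{1\le i\le l}N(x_i)$ where $l\ge 2$, $x_1,\ldots,x_l$ are distinct elements of $V_{p-1}$, and $|\bigcap_{1\le i\le l}N(x_i)|\ge 2$. The set $V^*_p$. - If $p\ge 5$: $V^*_p$ is the set of $X\in V^+_p$ such that $|\bigcap_{x\in X\cap V_{p-1}}N_{p-2}(x)|\ge 2$, and $N_{p-3}(x)=N_{p-3}(y)$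 for all $x,y\in X\cap V_{p-1}$, and $|\bigcap_{x\in X\cap V_{p-1}}N_1(x)|\ge 2$. - If $p=4$: $V^*_4$ is the set of $X\in V^+_4$ such that $|\bigcap_{x\in X\cap V_3}N_2(x)|\ge 2$, $|\bigcap_{x\in X\cap V_3}N_1(x)|\ge 2$, and $N_0(x)=N_0(y)$ for all $x,y\in X\cap V_3$. - If $p=3$: $V^*_3$ is the set of $X\in V^+_3$ such that $|\bigcap_{x\in X\cap V_2}N_1(x)|\ge 2$ and $|\bigcap_{x\in X\cap V_2}N_0(x)|\ge 2$. - If $p=2$: $V^*_2=V^+_2$. The clean-factor graph of a $p$-partite graph is its factorisation with respect to $V^*_p$. Clean-factor series of a graph $G$. $\mathcal{K}(G)$ is the set of maximal cliques of $G$. $G_1=B(G)$ is the vertex-clique-incidence bipartite graph: level $V_0=V(G)$, level $V_1=\mathcal{K}(G)$, with an edge $vC$ whenever $v\in C$. For $i\ge 1$, $G_{i+1}$ is the clean-factor graph of $G_i$ if that factorisation is effective, and is undefined otherwise. The series is always finite; $M$ denotes its last defined graph, i.e. the $G_i$ whose clean-factor factorisation is not effective. *)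

(* Defs.v *)
From HB Require Import structures.
From mathcomp Require Import all_boot.

Set Implicit Arguments.
Unset Strict Implicit.
Unset Printing Implicit Defensive.

(* A simple graph is a symmetric irreflexive relation on a finType.  Cliques are
   non-empty, so that the graph without vertices has no maximal clique. *)
Definition clique (T : finType) (e : rel T) (C : {set T}) : bool :=
  (C != set0) && [forall x in C, forall y in C, (x != y) ==> e x y].

Definition max_cliques (T : finType) (e : rel T) : {set {set T}} :=
  [set C | maxset (clique e) C].

(* Levels are allowed to be empty here, because a non-effective factorisation
   has an empty last level; [clean_series_levels] shows that the levels of the
   graphs of the series are non-empty. *)
Record mpgraph (p : nat) := MPGraph {
  vert :> finType;
  lev : vert -> 'I_p;
  adj : rel vert;
  adj_sym : symmetric adj;
  adj_lev : forall x y, adj x y -> lev x != lev y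
}.

Definition level p (H : mpgraph p) (i : nat) : {set H} :=
  [set x | lev x == i :> nat].

Definition nbr p (H : mpgraph p) (x : H) : {set H} := [set y | adj x y].

Definition nbr_in p (H : mpgraph p) (i : nat) (x : H) : {set H} :=
  nbr x :&: level H i.

Section Factorisation.
Variables (p : nat) (H : mpgraph p) (S : {set {set H}}).

Definition new_level : {set {set H}} := [set X | maxset [in S] X].

Definition effective : bool := new_level != set0.

Definition factor_vert : finType := (H + {X : {set H} | X \in new_level})%type.

Definition factor_lev (u : factor_vert) : 'I_p.+1 :=
  match u with
  | inl x => widen_ord (leqnSn p) (lev x)
  | inr _ => ord_max
  end.

Definition factor_adj (u v : factor_vert) : bool :=
  match u, v with
  | inl x, inl y => adj x y
  | inl y, inr X => y \in val X
  | inr X, inl y => y \in val X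
  | inr _, inr _ => false
  end.

Fact factor_adj_sym : symmetric factor_adj.
Proof. by move=> [x|X] [y|Y] //=; apply: adj_sym. Qed.

Fact factor_adj_lev u v : factor_adj u v -> factor_lev u != factor_lev v.
Proof.
case: u v => [x|X] [y|Y] //=; rewrite -val_eqE /=.
- exact: adj_lev.
- by rewrite ltn_eqF.
- by rewrite eq_sym ltn_eqF.
Qed.

Definition factorisation : mpgraph p.+1 :=
  MPGraph factor_adj_sym factor_adj_lev.

End Factorisation.

Definition Vplus p (H : mpgraph p) : {set {set H}} :=
  [set A :|: \bigcap_(x in A) nbr x | A : {set H}
     & [&& A \subset level H (p - 1), 2 <= #|A|
         & 2 <= #|\bigcap_(x in A) nbr x| ]].

(* [clean X] is the condition selecting the elements of V*_p among V+_p. *)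
Definition clean p (H : mpgraph p) (X : {set H}) : bool :=
  let A := X :&: level H (p - 1) in
  let many i := 2 <= #|\bigcap_(x in A) nbr_in i x| in
  let same i := [forall x in A, forall y in A, nbr_in i x == nbr_in i y] in
  if 5 <= p then [&& many (p - 2), same (p - 3) & many 1]
  else if p == 4 then [&& many 2, many 1 & same 0]
  else if p == 3 then many 1 && many 0
  else true.

Definition Vstar p (H : mpgraph p) : {set {set H}} :=
  [set X in Vplus H | clean X].

Definition clean_factor p (H : mpgraph p) : mpgraph p.+1 :=
  factorisation (Vstar H).

Section Incidence.
Variables (T : finType) (e : rel T).

Definition inc_vert : finType := (T + {C : {set T} | C \in max_cliques e})%type.

Definition inc_lev (u : inc_vert) : 'I_2 :=
  match u with inl _ => ord0 | inr _ => ord_max end.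

Definition inc_adj (u v : inc_vert) : bool :=
  match u, v with
  | inl x, inr C => x \in val C
  | inr C, inl x => x \in val C
  | _, _ => false
  end.

Fact inc_adj_sym : symmetric inc_adj.
Proof. by move=> [x|X] [y|Y]. Qed.

Fact inc_adj_lev u v : inc_adj u v -> inc_lev u != inc_lev v.
Proof. by case: u v => [x|X] [y|Y]. Qed.

Definition incidence : mpgraph 2 := MPGraph inc_adj_sym inc_adj_lev.

(* [clean_series i] is the graph G_(i+1), which has i + 2 levels, or [None] when
   it is undefined. *)
Fixpoint clean_series (i : nat) : option (mpgraph i.+2) :=
  match i with
  | 0 => Some incidence
  | j.+1 =>
      if clean_series j is Some H then
        if effective (Vstar H) then Some (clean_factor H) else None
      else None
  end.

Definition series_ends_on (i : nat) (M : mpgraph i.+2) : Prop :=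
  clean_series i = Some M /\ ~~ effective (Vstar M).

Lemma clean_series_levels (i : nat) (H : mpgraph i.+2) :
  0 < #|T| -> clean_series i = Some H -> forall j : 'I_i.+2, level H j != set0.
Proof.
move=> T_gt0; elim: i H => [|i IHi] H /=.
  move=> [<-] j; have [x _] := card_gt0P T_gt0.
  have clx : clique e [set x].
    apply/andP; split; first by apply/set0Pn; exists x; rewrite set11.
    apply/forall_inP=> y /set1P->; apply/forall_inP=> z /set1P->.
    by rewrite eqxx.
  have [C maxC _] := maxset_exists clx.
  have CP : C \in max_cliques e by rewrite inE.
  case: j => -[|[|//]] ltj; apply/set0Pn.
    by exists (inl x : incidence); rewrite inE.
  by exists (inr (exist _ C CP) : incidence); rewrite inE.
case DHi: (clean_series i) => [Hi|] //; case: ifP => // effHi [<-] j.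
have [ltj|gej] := ltnP j i.+2.
  have /set0Pn[x xj] := IHi _ DHi (Ordinal ltj); rewrite inE in xj.
  by apply/set0Pn; exists (inl x : clean_factor Hi); rewrite inE.
have /set0Pn[X XP] := effHi; apply/set0Pn.
exists (inr (exist _ X XP) : clean_factor Hi); rewrite inE /=.
by rewrite eqn_leq gej /= -ltnS ltn_ord.
Qed.

End Incidence.

(* Main.v *)
Require Import Defs.
From mathcomp Require Import all_boot zify.

(* For a vertex [x] of level [q >= 2] write [N_j] for its neighbours of level
   [j < q], and let [a_j] be the set of maximal cliques adjacent to every element
   of [N_j].  Cleanness forces
     [a_(q-1) < ... < a_3 < a_2 < a_0]
   (strict inclusions), and maximality of the elements of V*_q allows one to
   recover [N_0, N_2, N_3, ...] one after the other from this chain, so that the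
   chain determines [x].  It lives in the set of the at most [k] maximal cliques
   containing any given vertex of [N_0].  All the [a_j] are Galois closed, so the
   intersections of the cliques in the [a_j] form a chain that also determines
   [x]; it lives in any clique of [N_1].  Finally, a set with [s] elements has at
   most [2^s s!] chains of non-empty subsets: apart from the whole set, a chain
   consists of subsets of the complement of some element. *)

Set Implicit Arguments.
Unset Strict Implicit.
Unset Printing Implicit Defensive.

Local Notation lvl x := (nat_of_ord (lev x)).

(** * Counting chains of non-empty subsets *)

Lemma card_bigcup_le (I T : finType) (B : {set I}) (F : I -> {set T}) m :
  (forall b, b \in B -> #|F b| <= m) -> #|\bigcup_(b in B) F b| <= #|B| * m.
Proof.
move=> Fm; rewrite -sum_nat_const.
apply: (big_ind2 (fun (A : {set T}) n => #|A| <= n)) => [|A1 n1 A2 n2 h1 h2|b /Fm//].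
  by rewrite cards0.
exact: leq_trans (leq_card_setU A1 A2) (leq_add h1 h2).
Qed.

Section Chains.
Variable T : finType.
Implicit Types (S : {set T}) (F : {set {set T}}).

Definition chains S : {set {set {set T}}} :=
  [set F : {set {set T}} | [&& F \subset powerset S, set0 \notin F
    & [forall A in F, forall B in F, (A \subset B) || (B \subset A)]]].

Lemma chainsP S F :
  reflect [/\ forall A, A \in F -> A \subset S, forall A, A \in F -> A != set0
            & forall A B, A \in F -> B \in F -> (A \subset B) || (B \subset A)]
          (F \in chains S).
Proof.
rewrite inE; apply: (iffP and3P) => [[sF F0 cF]|[sF F0 cF]]; split.
- by move=> A /(subsetP sF); rewrite inE.
- by move=> A AF; apply: contraNneq F0 => <-.
- by move=> A B AF BF; apply: (forall_inP (forall_inP cF A AF)).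
- by apply/subsetP=> A AF; rewrite inE sF.
- by apply/negP=> /F0; rewrite eqxx.
- by apply/forall_inP=> A AF; apply/forall_inP=> B BF; apply: cF.
Qed.

(* [x] is an element of [S] missed by the largest member of the chain. *)
Lemma chains_avoid S F : S != set0 -> F \in chains S ->
  exists2 x, x \in S & F :\ S \in chains (S :\ x).
Proof.
move=> /set0Pn[x0 x0S] /chainsP[sF F0 cF].
suff [x xS xF] : exists2 x, x \in S & forall A, A \in F :\ S -> x \notin A.
  exists x => //; apply/chainsP; split=> [A AF|A /setD1P[_ /F0]//|A B]; last first.
    by move=> /setD1P[_ AF] /setD1P[_ BF]; apply: cF.
  rewrite subsetD1 xF // andbT; apply: sF.
  by case/setD1P: AF.
have [->|[B0 B0F]] := set_0Vmem (F :\ S).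
  by exists x0 => // A; rewrite inE.
case: (arg_maxnP (fun A : {set T} => #|A|) B0F) => B BF maxB.
have /setD1P[BS BF'] := BF.
have : B \proper S by rewrite properEneq BS sF.
case/properP=> _ [x xS xB]; exists x => // A AF.
apply: contra xB => xA; have /setD1P[_ AF'] := AF.
have [/subsetP|BA] := orP (cF _ _ AF' BF'); first exact.
by have /eqP-> : B == A; rewrite // eqEcard BA; apply: maxB.
Qed.

(** Induction on [#|S|]. By [chains_avoid] there are at most [#|S|] choices for the missed element
    [x]. Once [x] is chosen, the chain is a chain in [S :\ x], with or without [S] added, which
    gives the factor 2. *)
Lemma card_chains S : #|chains S| <= 2 ^ #|S| * #|S|`!.
Proof.
move eqn: #|S| => n; elim: n => [|n IHn] in S eqn *.
  have -> : S = set0 by apply: cards0_eq.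
  suff sub : chains set0 \subset [set set0].
    by rewrite (leq_trans (subset_leq_card sub)) // cards1.
  apply/subsetP=> F /chainsP[sF F0 _]; rewrite inE; apply/eqP/setP=> A.
  rewrite inE; apply/negP=> AF; have := F0 _ AF.
  by rewrite -subset0 sF.
have S0 : S != set0 by rewrite -card_gt0 eqn.
pose G x := chains (S :\ x) :|: [set S |: F | F in chains (S :\ x)].
have sub : chains S \subset \bigcup_(x in S) G x.
  apply/subsetP=> F FS; have [x xS Fx] := chains_avoid S0 FS.
  apply/bigcupP; exists x => //; rewrite inE.
  have [SF|SF] := boolP (S \in F); last first.
    rewrite (_ : F = F :\ S) ?Fx //; apply/setP=> A; rewrite !inE.
    by case: eqVneq => // ->; rewrite (negbTE SF).
  by apply/orP; right; apply/imsetP; exists (F :\ S); rewrite ?setD1K.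
apply: leq_trans (subset_leq_card sub) _.
apply: (@leq_trans (#|S| * (2 * (2 ^ n * n`!)))); last first.
  by rewrite eqn factS expnS; lia.
apply: card_bigcup_le => x xS.
have cx : #|chains (S :\ x)| <= 2 ^ n * n`!.
  by apply: IHn; move: (cardsD1 x S); rewrite xS eqn; lia.
rewrite mul2n -addnn; apply: leq_trans (leq_card_setU _ _) (leq_add cx _).
exact: leq_trans (leq_imset_card _ _) cx.
Qed.

(** The counting scheme of both final bounds: [x] is encoded by a base point [r x] together with a
    chain in the small set [N (r x)]. *)
Lemma card_le_chains (D B : {set T}) (N : T -> {set T}) m
    (r : T -> T) (F : T -> {set {set T}}) :
  (forall b, b \in B -> #|N b| <= m) ->
  (forall x, x \in D -> r x \in B /\ F x \in chains (N (r x))) ->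
  {in D &, forall x y, r x = r y -> F x = F y -> x = y} ->
  #|D| <= #|B| * (2 ^ m * m`!).
Proof.
move=> Nm rF inj.
rewrite -(@card_in_imset _ _ (fun x => (r x, F x)) D); last first.
  by move=> x y xD yD [/inj]; apply.
pose G b := [set (b, E) | E in chains (N b)].
have sub : [set (r x, F x) | x in D] \subset \bigcup_(b in B) G b.
  apply/subsetP=> _ /imsetP[x /rF[rB Fr] ->]; apply/bigcupP; exists (r x) => //.
  exact: imset_f.
apply: leq_trans (subset_leq_card sub) _; apply: card_bigcup_le => b /Nm bm.
apply: leq_trans (leq_imset_card _ _) _; apply: leq_trans (card_chains _) _.
by apply: leq_mul; [rewrite leq_exp2l | apply: leq_fact].
Qed.

End Chains.

(** * Layered graphs and recovery of neighbourhoods *)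

(* The level on which the elements of level [j] of a member of V*_(j+1) must
   have the same neighbours, for [j >= 3]. *)
Definition same_level (j : nat) : nat := if j == 3 then 0 else j - 2.

Lemma same_level_lt j : 2 < j -> same_level j < j.-1 /\ same_level j != 1.
Proof. by rewrite /same_level; case: ifP; lia. Qed.

(* The vertices of level [q >= 2] are the maximal elements of V*_q.  Every clause
   about [x] only involves vertices below [x], so that adding a level on top
   preserves it. *)
Record layered p (H : mpgraph p) : Prop := Layered {
  layered_two : forall (x : H) j, 1 < lvl x -> j < lvl x ->
    [|| j == (lvl x).-1, j == (lvl x).-2, j == 1 | lvl x <= 3] ->
    exists y1 y2 : H, [/\ y1 != y2, adj x y1, adj x y2, lvl y1 = j & lvl y2 = j];
  layered_complete : forall x y z : H, adj x y -> adj x z ->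
    lvl y < lvl x -> lvl z < lvl x -> lvl y != lvl z -> adj y z;
  layered_ext : forall x x' : H, 1 < lvl x -> lvl x = lvl x' ->
    (forall y : H, lvl y < lvl x -> adj x y = adj x' y) -> x = x';
  layered_inter : forall x w : H, lvl w < (lvl x).-1 ->
    (forall y : H, lvl y = (lvl x).-1 -> adj x y -> adj y w) -> adj x w;
  layered_same : forall x y y' w : H, 3 < lvl x -> adj x y -> adj x y' ->
    lvl y = (lvl x).-1 -> lvl y' = (lvl x).-1 ->
    lvl w = same_level (lvl x).-1 -> adj y w -> adj y' w;
  layered_max : forall x y : H, 1 < lvl x -> lvl y = (lvl x).-1 ->
    (forall w : H, lvl w < lvl y -> adj x w -> adj y w) ->
    (3 < lvl x ->
      forall w : H, lvl w = same_level (lvl y) -> adj y w -> adj x w) ->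
    adj x y
}.

Section LayeredTheory.
Variables (p : nat) (H : mpgraph p) (HL : layered H).
Implicit Types x y z w u : H.

Let complete := layered_complete HL.

(** Away from level 1, and at least two levels below [y], a single neighbour [y] of [x] already
    decides the neighbours of [x]. The proof is by induction on the level of [x], going from [y] up
    to the level just below [x] and then to [x]. *)
Lemma same_adj x y w m : 2 < m -> m < lvl x -> lvl y = m -> adj x y ->
  lvl w < m.-1 -> lvl w != 1 -> adj y w -> adj x w.
Proof.
have [q leq] := ubnP (lvl x); elim: q x y w m leq => // q IHq x y w m leq.
(* Case of [y'] just below [x']. By [layered_inter] it suffices that every other neighbour [y2] just
   below [x'] sees [w]. This is [layered_same] when [w] lies on [same_level]. Otherwise a neighbour
   [z] of [x'] two levels down is adjacent to [y'], [y2] and [w], and induction applies to [y2] and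
   [z]. *)
have top x' y' : lvl x' < q.+1 -> 3 < lvl x' -> lvl y' = (lvl x').-1 -> adj x' y' ->
    lvl w < (lvl x').-2 -> lvl w != 1 -> adj y' w -> adj x' w.
  move=> ltq x3 ly xy lw w1 yw; apply: (layered_inter HL); first by lia.
  move=> y2 ly2 xy2.
  have [ws|ws] := eqVneq (lvl w) (same_level (lvl x').-1).
    exact: (layered_same HL (x := x') (y := y')).
  have [x4 lw'] : 4 < lvl x' /\ lvl w < (lvl x').-1.-2.
    by move: ws; rewrite /same_level; case: ifP; lia.
  have [|||z [_ [_ xz _ lz _]]] := layered_two HL (x := x') (j := (lvl x').-2).
  - by lia.
  - by lia.
  - by rewrite eqxx orbT.
  have yz : adj y' z by apply: (complete xy xz); lia.
  have y2z : adj y2 z by apply: (complete xy2 xz); lia.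
  have zw : adj z w.
    by apply: (complete yz yw); lia.
  by apply: (IHq y2 z w (lvl x').-2) => //; lia.
move=> m2 mx ly xy lw w1 yw.
have [mq|mq] := eqVneq m (lvl x).-1.
  by apply: (top x y) => //; lia.
have [|||u [_ [_ xu _ lu _]]] := layered_two HL (x := x) (j := (lvl x).-1).
- by lia.
- by lia.
- by rewrite eqxx.
have uy : adj u y by apply: (complete xu xy); lia.
apply: (top x u) => //; try lia.
by apply: (IHq u y w m) => //; lia.
Qed.

(** On the levels not covered by [layered_two], the two neighbours of some [y] just below [x] are
    passed up to [x] by [same_adj]. *)
Lemma two_nbrs x j : 1 < lvl x -> j < lvl x ->
  exists y1 y2, [/\ y1 != y2, adj x y1, adj x y2, lvl y1 = j & lvl y2 = j].
Proof.
have [q leq] := ubnP (lvl x); elim: q x leq => // q IHq x leq.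
move=> x1 jx.
have [c|] := boolP [|| j == (lvl x).-1, j == (lvl x).-2, j == 1 | lvl x <= 3].
  exact: layered_two.
rewrite !negb_or => /and4P[j1 j2 j3 x3].
have [|||y [_ [_ xy _ ly _]]] := layered_two HL (x := x) (j := (lvl x).-1).
- by lia.
- by lia.
- by rewrite eqxx.
have [| | |w1 [w2 [w12 yw1 yw2 lw1 lw2]]] := IHq y; try lia.
exists w1, w2; split=> //.
  by apply: (same_adj (y := y) (m := (lvl x).-1)) => //; lia.
by apply: (same_adj (y := y) (m := (lvl x).-1)) => //; lia.
Qed.

Lemma some_nbr x j : 1 < lvl x -> j < lvl x -> exists2 y, adj x y & lvl y = j.
Proof. by move=> x1 jx; have [y [_ [_ xy _ ly _]]] := two_nbrs x1 jx; exists y. Qed.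

(** The neighbours on the level just below are recovered by maximality: a neighbour of [x'] there
    satisfies the hypotheses of [layered_max] for [x], since these only involve lower levels, where
    [x] and [x'] agree. *)
Lemma lower_ext x x' : 1 < lvl x -> lvl x = lvl x' ->
  (forall w, lvl w < (lvl x).-1 -> adj x w = adj x' w) -> x = x'.
Proof.
have sub x1 x2 y : 1 < lvl x1 -> lvl x1 = lvl x2 ->
    (forall w, lvl w < (lvl x1).-1 -> adj x1 w = adj x2 w) ->
    lvl y = (lvl x1).-1 -> adj x2 y -> adj x1 y.
  move=> l1 l12 eqw ly x2y; apply: (layered_max HL) => //.
    move=> w lw x1w; apply: (complete (x := x2)) => //; try lia.
    by rewrite -eqw //; lia.
  move=> l3 w lw yw.
  have lwy : lvl w < (lvl x1).-1.
    by move: lw; rewrite /same_level; case: ifP; lia.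
  rewrite eqw //; apply: (layered_inter HL); first by lia.
  move=> y2 ly2 x2y2; apply: (layered_same HL (x := x2) (y := y)) => //; try lia.
  by rewrite -l12 -ly.
move=> x1 lxx eqw; apply: (layered_ext HL) => // y ly.
have [ltw|geq] := ltnP (lvl y) (lvl x).-1; first exact: eqw.
apply/idP/idP => [|] hy; last by apply: (sub x x') => //; lia.
apply: (sub x' x) => //; try lia.
by move=> w lw; rewrite eqw //; lia.
Qed.

(** * The chain of sets of cliques *)

(* [a_j] of the header; for [j = 0], the cliques containing [N_0]. *)
Definition common (j : nat) x : {set H} :=
  [set C | (lvl C == 1) && [forall z, (lvl z == j) && adj x z ==> adj z C]].

Lemma commonP j x C :
  reflect (lvl C = 1 /\ forall z, lvl z = j -> adj x z -> adj z C) (C \in common j x).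
Proof.
rewrite inE; apply: (iffP andP) => [[/eqP lC /forallP aC]|[lC aC]]; split=> //.
- by move=> z lz xz; apply: (implyP (aC z)); rewrite lz eqxx.
- by apply/eqP.
- by apply/forallP=> z; apply/implyP=> /andP[/eqP lz xz]; apply: aC.
Qed.

Lemma common_nbr j x C : 1 < lvl x -> j < lvl x -> j != 1 -> lvl C = 1 -> adj x C ->
  C \in common j x.
Proof.
move=> x1 jx j1 lC xC; apply/commonP; split=> // z lz xz.
by apply: (complete xz xC); lia.
Qed.

Lemma common_mono j x y : lvl y < lvl x -> j < lvl y -> adj x y ->
  common j y \subset common j x.
Proof.
move=> lyx jy xy; apply/subsetP=> C /commonP[lC aC]; apply/commonP; split=> // z lz xz.
by apply: aC => //; apply: (complete xy xz); lia.
Qed.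

(** If [j] is the level just below [x], this is maximality, the neighbours of [x] on level 1 being
    elements of [common j x]. Otherwise the hypotheses pass to every neighbour [y] just below [x],
    because [common j y] is contained in [common j x], and [layered_inter] concludes. *)
Lemma adj_common x z j : 1 < j -> j < lvl x -> lvl z = j ->
  (forall w, lvl w < j -> lvl w != 1 -> adj x w -> adj z w) ->
  (2 < j -> forall w, lvl w = same_level j -> adj z w -> adj x w) ->
  (forall C, C \in common j x -> adj z C) -> adj x z.
Proof.
have [q leq] := ubnP (lvl x); elim: q x leq => // q IHq x leq.
move=> j1 jx lz zlow zs zC.
have [jq|jq] := eqVneq j (lvl x).-1.
  apply: (layered_max HL); try lia.
    move=> w lw xw; have [w1|w1] := eqVneq (lvl w) 1; last by apply: zlow => //; lia.
    by apply: zC; apply: common_nbr => //; lia.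
  by move=> l3 w lw zw; apply: zs => //; [lia | rewrite lw lz].
apply: (layered_inter HL); first by lia.
move=> y ly xy; apply: (IHq y) => //; try lia.
- move=> w lw w1 yw; apply: zlow => //.
  by apply: (same_adj (y := y) (m := (lvl x).-1)) => //; lia.
- move=> j2 w lw zw.
  have lwj : lvl w < j by rewrite lw /same_level; case: ifP; lia.
  by apply: (complete xy); try lia; apply: zs.
- move=> C; move/(subsetP (common_mono (x := x) _ _ xy)) => CC.
  by apply: zC; apply: CC; lia.
Qed.

(** Descent by [layered_inter] to level 2, where the neighbours just below are cliques belonging to
    [common 0 x]. *)
Lemma adj_common0 x v : 1 < lvl x -> lvl v = 0 ->
  (forall C, C \in common 0 x -> adj v C) -> adj x v.
Proof.
have [q leq] := ubnP (lvl x); elim: q x leq => // q IHq x leq.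
move=> x1 lv vC; apply: (layered_inter HL); first by lia.
move=> y ly xy; have [x2|x2] := eqVneq (lvl x) 2.
  by rewrite adj_sym; apply: vC; apply: common_nbr => //; lia.
apply: IHq => //; try lia.
by move=> C /(subsetP (common_mono (x := x) _ _ xy)) CC; apply: vC; apply: CC; lia.
Qed.

(* Level 1 is skipped: the chain uses the levels 0, 2, 3, ... *)
Definition chain_index (i : nat) : nat := if i is i'.+1 then i.+1 else 0.

(** A neighbour [y] of [x] on level [i.+2] is adjacent to both [z] and [C], so completeness below
    [y] makes [z] and [C] adjacent. *)
Lemma common_sub x i : 1 < lvl x -> i.+2 < lvl x ->
  common i.+2 x \subset common (chain_index i) x.
Proof.
move=> x1 ix; apply/subsetP=> C /commonP[lC aC]; apply/commonP; split=> // z lz xz.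
have [y xy ly] := some_nbr x1 ix.
have lzi : lvl z < i.+2 /\ lvl z != 1 by rewrite lz; case: (i).
have yz : adj y z by apply: (complete xy xz); lia.
have yC : adj y C by apply: aC.
by apply: (complete yz yC); lia.
Qed.

(** If equality held, two distinct neighbours of [x] on level [i.+2] would have the same lower
    neighbours, against [lower_ext]. *)
Lemma common_proper x i : 1 < lvl x -> i.+2 < lvl x ->
  common i.+2 x \proper common (chain_index i) x.
Proof.
move=> x1 ix; rewrite properE common_sub //=; apply/negP=> /subsetP sub.
have [y [y' [/eqP yy' xy xy' ly ly']]] := two_nbrs x1 ix; apply: yy'.
(* Under the assumed equality, every neighbour of [x] on level [i.+2] has exactly [common i.+2 x] as
   its set of cliques. *)
have nbr1 u C : lvl u = i.+2 -> adj x u -> lvl C = 1 ->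
    adj u C = (C \in common i.+2 x).
  move=> lu xu lC; apply/idP/idP => [uC|/commonP[_]]; last exact.
  apply: sub; apply/commonP; split=> // z lz xz.
  have lzi : lvl z < i.+2 /\ lvl z != 1 by rewrite lz; case: (i).
  have uz : adj u z by apply: (complete xu xz); lia.
  by apply: (complete uz uC); lia.
have eq1 C : lvl C = 1 -> adj y C = adj y' C by move=> lC; rewrite (nbr1 y) ?(nbr1 y').
case: i => [|i] in ix ly ly' {nbr1 sub} *.
  (* On level 2, the neighbours on level 0 are determined by those on level 1. *)
  have sub y1 y2 v : lvl y1 = 2 -> lvl y2 = 2 -> (forall C, lvl C = 1 -> adj y1 C = adj y2 C) ->
     lvl v = 0 -> adj y1 v -> adj y2 v.
    move=> l1 l2 e12 lv y1v; apply: (layered_inter HL); first by lia.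
    move=> C lC y2C; apply: (complete (x := y1)) => //; try lia.
    by rewrite e12 //; lia.
  apply: lower_ext; [lia|lia|] => v lv.
  by apply/idP/idP; apply: sub => //; try lia; move=> C /eq1->.
(* Away from level 1, a neighbour of [y1] is passed up to [x] by [same_adj], then down to [y2] by
   completeness. *)
have shift y1 y2 w : lvl y1 = i.+3 -> lvl y2 = i.+3 -> adj x y1 -> adj x y2 ->
   lvl w < i.+2 -> lvl w != 1 -> adj y1 w -> adj y2 w.
  move=> l1 l2 xy1 xy2 lw w1 y1w; apply: (complete xy2); try lia.
  by apply: (same_adj (y := y1) (m := i.+3)) => //; lia.
apply: lower_ext; [lia|lia|] => w lw.
have [w1|w1] := eqVneq (lvl w) 1; first exact: eq1.
by apply/idP/idP; apply: shift => //; lia.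
Qed.

Definition chain_seq x : seq {set H} :=
  [seq common (chain_index i) x | i <- iota 0 (lvl x).-1].

Definition chain_fam x : {set {set H}} := [set A in chain_seq x].

Lemma size_chain_seq x : size (chain_seq x) = (lvl x).-1.
Proof. by rewrite size_map size_iota. Qed.

Lemma nth_chain_seq x i : i < (lvl x).-1 ->
  nth set0 (chain_seq x) i = common (chain_index i) x.
Proof. by move=> ix; rewrite (nth_map 0) ?size_iota // nth_iota. Qed.

Lemma chain_famP x A :
  reflect (exists2 i, i < (lvl x).-1 & A = common (chain_index i) x) (A \in chain_fam x).
Proof.
rewrite inE; apply: (iffP mapP) => [[i]|[i ix ->]].
  by rewrite mem_iota => /andP[_ ix] ->; exists i.
by exists i => //; rewrite mem_iota.
Qed.

Lemma chain_index_bound x i : 1 < lvl x -> i < (lvl x).-1 ->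
  chain_index i < lvl x /\ chain_index i != 1.
Proof. by case: i => [|i] /=; lia. Qed.

Lemma chain_seq_sorted x : 1 < lvl x ->
  sorted (fun A B : {set H} => B \proper A) (chain_seq x).
Proof.
move=> x1; apply/(sortedP set0) => i; rewrite size_chain_seq => ix.
rewrite !nth_chain_seq //; last by lia.
by apply: common_proper => //; lia.
Qed.

Lemma proper_rev_trans : transitive (fun A B : {set H} => B \proper A).
Proof. by move=> B A C BA CB; apply: proper_trans CB BA. Qed.

Lemma chain_common_sub x i j : 1 < lvl x -> i <= j -> j < (lvl x).-1 ->
  common (chain_index j) x \subset common (chain_index i) x.
Proof.
move=> x1; rewrite leq_eqVlt => /predU1P[->//|ij] jx; apply: proper_sub.
rewrite -!nth_chain_seq //; last exact: ltn_trans jx.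
apply: (sorted_ltn_nth proper_rev_trans _ (chain_seq_sorted x1)) => //.
  by rewrite inE size_chain_seq (ltn_trans ij).
by rewrite inE size_chain_seq.
Qed.

Lemma chain_fam_comparable x A B : 1 < lvl x ->
  A \in chain_fam x -> B \in chain_fam x -> (A \subset B) || (B \subset A).
Proof.
move=> x1 /chain_famP[i ix ->] /chain_famP[j jx ->].
have [ij|/ltnW ji] := leqP i j; first by rewrite [X in _ || X]chain_common_sub ?orbT.
by rewrite chain_common_sub.
Qed.

(** A strictly decreasing sequence is determined by the set of its terms, and its length gives the
    level of the vertex. *)
Lemma chain_fam_eq_common x x' : 1 < lvl x -> 1 < lvl x' -> chain_fam x = chain_fam x' ->
  lvl x = lvl x' /\
  forall j, j != 1 -> j < lvl x -> common j x = common j x'.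
Proof.
move=> x1 x1' eqF.
have eqs : chain_seq x = chain_seq x'.
  apply: (irr_sorted_eq proper_rev_trans _ (chain_seq_sorted x1) (chain_seq_sorted x1')).
    by move=> A; rewrite properxx.
  by move=> A; move/setP/(_ A): eqF; rewrite !inE.
have eql : lvl x = lvl x'.
  by have := congr1 size eqs; rewrite !size_chain_seq; lia.
split=> // j j1 jx.
have [i ij ix] : exists2 i, chain_index i = j & i < (lvl x).-1.
  by case: j j1 jx => [|[|j]] // _ jx; [exists 0 | exists j.+1] => //; lia.
by have := congr1 (nth set0 ^~ i) eqs; rewrite !nth_chain_seq ?ij -?eql.
Qed.

(** The neighbours on levels 0, 2, 3, ... are recovered by strong induction on the level, using
    [adj_common0] and [adj_common]; level 1 comes last. *)
Lemma chain_fam_inj x x' : 1 < lvl x -> 1 < lvl x' -> chain_fam x = chain_fam x' -> x = x'.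
Proof.
move=> x1 x1' /(chain_fam_eq_common x1 x1')[eql eqc].
have sub0 y y' v : 1 < lvl y -> lvl y' = lvl y -> common 0 y = common 0 y' -> lvl v = 0 ->
    adj y v -> adj y' v.
  move=> y1 ly e lv yv; apply: adj_common0 => // [|C]; first by lia.
  by rewrite -e => /commonP[_]; apply.
have subS y y' j z : 1 < lvl y -> lvl y' = lvl y -> common j y = common j y' ->
    1 < j -> j < lvl y -> (forall w, lvl w < j -> lvl w != 1 -> adj y w = adj y' w) ->
    lvl z = j -> adj y z -> adj y' z.
  move=> y1 ly e j1 jy IH lz yz; apply: (adj_common (j := j)) => //; try lia.
  - move=> w lw w1; rewrite -IH // => yw.
    by apply: (complete yz yw); lia.
  - move=> j2 w lw zw.
    have [lwj w1] : lvl w < j.-1 /\ lvl w != 1.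
      by rewrite lw /same_level; case: ifP; lia.
    rewrite -IH //; last by lia.
    by apply: (same_adj (y := z) (m := j)).
  - by move=> C; rewrite -e => /commonP[_]; apply.
have eqadj j w : lvl w = j -> j != 1 -> j < lvl x -> adj x w = adj x' w.
  have [m lem] := ubnP j; elim: m j w lem => // m IHm j w lem lw j1 jx.
  have IH u : lvl u < j -> lvl u != 1 -> adj x u = adj x' u.
    by move=> lu u1; apply: (IHm (lvl u)) => //; lia.
  have [j0|j0] := eqVneq j 0.
    apply/idP/idP; apply: sub0; rewrite ?eqc ?lw //; lia.
  apply/idP/idP; apply: subS lw => //; rewrite ?eqc //; try lia.
  by move=> u lu u1; rewrite IH.
apply: lower_ext => // w lw.
have [w1|w1] := eqVneq (lvl w) 1; last by apply: eqadj => //; lia.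
(* Above level 2, the cliques adjacent to [y] are exactly those of [common (lvl y).-1 y], the
   smallest set of the chain. *)
have sub1 y y' : 2 < lvl y -> lvl y' = lvl y ->
    common (lvl y).-1 y = common (lvl y).-1 y' -> adj y w -> adj y' w.
  move=> y2 ly e yw; apply: (layered_inter HL); first by lia.
  move=> z lz yz.
  have : w \in common (lvl y).-1 y by apply: common_nbr; lia.
  by rewrite e => /commonP[_]; apply=> //; rewrite -ly.
by apply/idP/idP; apply: sub1 => //; rewrite -?eql ?eqc //; lia.
Qed.

(** * The dual chain of sets of vertices *)

(** For a set of cliques, this is their intersection, as a set of vertices of level 0: one of the
    two maps of the Galois connection given by incidence. *)
Definition dual (A : {set H}) : {set H} :=
  [set v | (lvl v == 0) && [forall C in A, adj v C]].

Lemma dualP (A : {set H}) v :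
  reflect (lvl v = 0 /\ forall C, C \in A -> adj v C) (v \in dual A).
Proof.
rewrite inE; apply: (iffP andP) => [[/eqP lv /forall_inP aA]|[lv aA]]; split=> //.
- by apply/eqP.
- exact/forall_inP.
Qed.

Lemma dualS (A B : {set H}) : A \subset B -> dual B \subset dual A.
Proof.
move=> /subsetP AB; apply/subsetP=> v /dualP[lv vB]; apply/dualP; split=> // C CA.
exact: vB (AB _ CA).
Qed.

(** The set of cliques adjacent to [x] is Galois closed. On level 2 this is the maximality of [x].
    Higher up, a neighbour [y] just below [x] sees all the cliques that [x] sees, so the hypothesis
    passes to [y] and [layered_inter] concludes. *)
Lemma nbr_closed x C : 1 < lvl x -> lvl C = 1 ->
  (forall v, lvl v = 0 -> (forall C', lvl C' = 1 -> adj x C' -> adj v C') -> adj v C) ->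
  adj x C.
Proof.
have [q leq] := ubnP (lvl x); elim: q x leq => // q IHq x leq x1 lC vC.
have [x2|x2] := eqVneq (lvl x) 2.
  apply: (layered_max HL) => //; try lia.
  move=> v lv xv; rewrite adj_sym; apply: vC; first by lia.
  by move=> C' lC' xC'; apply: (complete xv xC'); lia.
apply: (layered_inter HL); first by lia.
move=> y ly xy; apply: IHq => //; try lia.
move=> v lv vy; apply: vC => // C' lC' xC'; apply: vy => //.
by apply: (complete xy xC'); lia.
Qed.

(** [common j x] is the intersection, over the neighbours [z] of [x] on level [j], of the sets of
    cliques adjacent to [z]. Each of these is closed: by [nbr_closed] if [j >= 2], and because [z]
    itself lies in the dual if [j = 0]. *)
Lemma common_closed j x C : 1 < lvl x -> j < lvl x -> j != 1 -> lvl C = 1 ->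
  (forall v, v \in dual (common j x) -> adj v C) -> C \in common j x.
Proof.
move=> x1 jx j1 lC vC; apply/commonP; split=> // z lz xz.
have [j0|j0] := eqVneq j 0.
  apply: vC; apply/dualP; split=> [|C' /commonP[_]]; first by lia.
  exact.
apply: nbr_closed => //; first by lia.
move=> v lv vz; apply: vC; apply/dualP; split=> // C' /commonP[lC' aC'].
by apply: vz => //; apply: aC'.
Qed.

Definition dual_fam x : {set {set H}} := dual @: chain_fam x.

(** The sets of the chain are closed, hence determined by their duals. *)
Lemma dual_fam_inj x x' : 1 < lvl x -> 1 < lvl x' -> dual_fam x = dual_fam x' -> x = x'.
Proof.
move=> x1 x1' eqD; apply: chain_fam_inj => //.
suff sub y y' : 1 < lvl y -> 1 < lvl y' -> dual_fam y = dual_fam y' ->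
    chain_fam y \subset chain_fam y'.
  by apply/eqP; rewrite eqEsubset !sub.
move=> y1 y1' {}eqD; apply/subsetP=> A AF.
have: dual A \in dual_fam y' by rewrite -eqD imset_f.
case/imsetP=> B BF eqAB; suff -> : A = B by [].
have closed u D C : 1 < lvl u -> D \in chain_fam u -> lvl C = 1 ->
    (forall v, v \in dual D -> adj v C) -> C \in D.
  move=> u1 /chain_famP[i iu ->] lC; have [] := chain_index_bound u1 iu.
  by move=> ? ?; apply: common_closed.
have sub u u' D D' : 1 < lvl u -> 1 < lvl u' -> D \in chain_fam u -> D' \in chain_fam u' ->
    dual D = dual D' -> D \subset D'.
  move=> u1 u1' DF DF' eqDD; apply/subsetP=> C CD; apply: closed DF' _ _ => //.
    by case/chain_famP: DF CD => i _ -> /commonP[].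
  by move=> v; rewrite -eqDD => /dualP[_]; apply.
by apply/eqP; rewrite eqEsubset (sub y y') // (sub y' y).
Qed.

Lemma nbr_chain_fam x A C : 1 < lvl x -> A \in chain_fam x -> lvl C = 1 -> adj x C -> C \in A.
Proof.
move=> x1 /chain_famP[i ix ->] lC xC; have [? ?] := chain_index_bound x1 ix.
exact: common_nbr.
Qed.

Lemma chain_fam_common0 x A : 1 < lvl x -> A \in chain_fam x -> A \subset common 0 x.
Proof. by move=> x1 /chain_famP[i ix ->]; apply: (chain_common_sub (i := 0)). Qed.

Lemma nbr_dual_fam x B v : 1 < lvl x -> B \in dual_fam x -> lvl v = 0 -> adj x v -> v \in B.
Proof.
move=> x1 /imsetP[A AF ->] lv xv; apply/dualP; split=> // C.
by move/(subsetP (chain_fam_common0 x1 AF))/commonP=> -[_]; apply.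
Qed.
End LayeredTheory.

(** * Clean factorisation preserves the layered structure *)

Section CleanFactor.
Variables (p : nat) (H : mpgraph p).
Hypothesis p_gt1 : 1 < p.
Implicit Types (x y z w : H) (A X : {set H}).

Definition core A : {set H} := \bigcap_(x in A) nbr x.

Definition uniform A j := [forall x in A, forall y in A, nbr_in j x == nbr_in j y].

Lemma coreP A z : reflect (forall x, x \in A -> adj x z) (z \in core A).
Proof. by apply: (iffP bigcapP) => h x /h; rewrite inE. Qed.

Lemma core_inP A j z :
  reflect (forall x, x \in A -> adj x z /\ lvl z = j) (z \in \bigcap_(x in A) nbr_in j x).
Proof.
apply: (iffP bigcapP) => h x /h; rewrite !inE; first by case/andP=> ? /eqP.
by case=> -> /eqP.
Qed.

Lemma uniformP A j :
  reflect (forall x y z, x \in A -> y \in A -> lvl z = j -> adj x z -> adj y z)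
          (uniform A j).
Proof.
apply: (iffP forall_inP) => [uA x y z xA yA lz|uA x xA].
  have /eqP/setP/(_ z) := forall_inP (uA x xA) y yA.
  by rewrite !inE lz eqxx !andbT => ->.
apply/forall_inP=> y yA; apply/eqP/setP=> z; rewrite !inE.
have [lz|_] := eqVneq (lvl z) j; last by rewrite !andbF.
by rewrite !andbT; apply/idP/idP; apply: uA.
Qed.

(** The test [clean] stated on the generating set: the last-level part of [A :|: core A] is [A]
    itself, see [clean_core]. *)
Definition clean_on A : bool :=
  let many i := 2 <= #|\bigcap_(x in A) nbr_in i x| in
  if 5 <= p then [&& many (p - 2), uniform A (p - 3) & many 1]
  else if p == 4 then [&& many 2, many 1 & uniform A 0]
  else if p == 3 then many 1 && many 0
  else true.

Lemma core_lvl A x z : A \subset level H (p - 1) -> x \in A -> z \in core A -> lvl z < p.-1.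
Proof.
move=> /subsetP sA xA /coreP/(_ x xA) /adj_lev; rewrite -val_eqE /=.
by move: (sA _ xA); rewrite inE => /eqP ->; have := ltn_ord (lev z); lia.
Qed.

(** For [p >= 3] cleanness asks for exactly these levels. For [p = 2] it asks for nothing, but then
    the whole core lies on level 0. *)
Lemma card_core_in A j : A \subset level H (p - 1) -> 1 < #|A| -> 1 < #|core A| ->
  clean_on A -> j < p.-1 -> [|| j == p.-2, j == 1 | p <= 3] ->
  1 < #|\bigcap_(x in A) nbr_in j x|.
Proof.
move=> sA A1 c1 clA jp cond; have [p2|p2] := eqVneq p 2.
  apply: leq_trans c1 (subset_leq_card _); apply/subsetP=> z zA.
  apply/core_inP=> x xA; split; first exact: (coreP _ _ zA).
  by have := core_lvl sA xA zA; lia.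
move: clA; rewrite /clean_on; case: ifP => [p5 /and3P[h1 _ h2]|].
  have [->//|j1] := eqVneq j 1; suff -> : j = p - 2 by []; lia.
case: ifP => [/eqP p4 _ /and3P[h1 h2 _]|].
  have [->//|j1] := eqVneq j 1; suff -> : j = 2 by []; lia.
case: ifP => [/eqP p3 _ _ /andP[h1 h0]|]; last by lia.
have [->//|j1] := eqVneq j 1; suff -> : j = 0 by []; lia.
Qed.

Lemma clean_on_uniform A : 3 < p -> clean_on A -> uniform A (same_level p.-1).
Proof.
move=> p3; rewrite /clean_on /same_level; case: ifP => [p5 /and3P[_ h _]|p5].
  by rewrite ifF; [suff -> : p.-1 - 2 = p - 3 by []; lia | lia].
by rewrite ifT; [move=> /and3P[_ _ h]; rewrite ifT //; lia|lia].
Qed.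

Lemma clean_on_ext A A' :
  (forall j, j < p.-1 ->
    \bigcap_(x in A) nbr_in j x = \bigcap_(x in A') nbr_in j x) ->
  (3 < p -> uniform A' (same_level p.-1)) -> clean_on A -> clean_on A'.
Proof.
move=> eqA uA'; rewrite /clean_on; case: ifP => [p5|].
  rewrite !eqA; [|lia|lia]; move=> /and3P[-> _ ->]; rewrite andbT /=.
  have := uA'; rewrite /same_level ifF; last by lia.
  by (have -> : p - 3 = p.-1 - 2 by lia); apply; lia.
case: ifP => [/eqP p4 _|].
  rewrite !eqA; [|lia|lia]; move=> /and3P[-> -> _] /=.
  by have := uA'; rewrite /same_level ifT; [apply; lia|lia].
by case: ifP => // /eqP p3 _ _; rewrite !eqA //; lia.
Qed.

Lemma biclique_top A : A \subset level H (p - 1) -> 0 < #|A| ->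
  (A :|: core A) :&: level H (p - 1) = A.
Proof.
move=> sA /card_gt0P[x xA]; apply/setP=> z; rewrite in_setI in_setU.
apply/andP/idP => [[/orP[//|zA]]|zA]; last by rewrite zA (subsetP sA).
by rewrite inE => /eqP lz; have := core_lvl sA xA zA; lia.
Qed.

Lemma clean_core A : A \subset level H (p - 1) -> 0 < #|A| ->
  clean (A :|: core A) = clean_on A.
Proof.
move=> sA A0.
by rewrite -[LHS]/(clean_on ((A :|: core A) :&: level H (p - 1))) biclique_top.
Qed.

Lemma VstarP X :
  reflect (exists A, [/\ A \subset level H (p - 1), 1 < #|A|, 1 < #|core A|,
                         clean_on A & X = A :|: core A])
          (X \in Vstar H).
Proof.
rewrite inE; apply: (iffP andP) => [[/imsetP[A + ->]]|[A [sA A1 c1 clA ->]]].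
  rewrite inE => /and3P[sA A1 c1] clX; exists A; split=> //.
  by rewrite -clean_core // ltnW.
split; first by apply/imsetP; exists A => //; rewrite inE sA A1; apply: c1.
by rewrite clean_core // ltnW.
Qed.

Hypothesis HL : layered H.

Lemma core_complete A y z : A \subset level H (p - 1) -> 0 < #|A| ->
  y \in core A -> z \in core A -> lvl y != lvl z -> adj y z.
Proof.
move=> sA /card_gt0P[x xA] yA zA; apply: (layered_complete HL (coreP _ _ yA x xA)).
- exact: (coreP _ _ zA).
- by move: (subsetP sA x xA); rewrite inE => /eqP->; have := core_lvl sA xA yA; lia.
- by move: (subsetP sA x xA); rewrite inE => /eqP->; have := core_lvl sA xA zA; lia.
Qed.

(** Adding [y] to the generators of [X] changes neither the core nor cleanness, so [y |: X] is again
    in [Vstar H]; maximality of [X] then puts [y] in [X]. *)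
Lemma new_level_max X y : X \in new_level (Vstar H) -> lvl y = p.-1 ->
  (forall w, lvl w < p.-1 -> w \in X -> adj y w) ->
  (3 < p -> forall w, lvl w = same_level p.-1 -> adj y w -> w \in X) ->
  y \in X.
Proof.
rewrite inE => /maxsetP[/VstarP[A [sA A1 c1 clA eX]] maxX] ly lowX sameX.
have /card_gt0P[x0 x0A] := ltnW A1.
have coreX w : w \in core A -> adj y w.
  by move=> wA; apply: lowX; [exact: core_lvl sA x0A wA|rewrite eX inE wA orbT].
have eqcore : core (y |: A) = core A.
  apply/setP=> w; apply/coreP/coreP => [h x xA|h x]; first by apply: h; rewrite inE xA orbT.
  by case/setU1P=> [->|]; [apply: coreX; apply/coreP|apply: h].
suff: y |: X \in Vstar H.
  by move=> /maxX <-; [rewrite setU11|rewrite subsetU1].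
apply/VstarP; exists (y |: A); split.
- by rewrite subUset sA andbT sub1set inE; apply/eqP; lia.
- by apply: leq_trans A1 (subset_leq_card (subsetU1 _ _)).
- by rewrite eqcore.
- apply: (clean_on_ext _ _ clA) => [j jp|p3].
    apply/setP=> w; apply/core_inP/core_inP => [h x|h x xA]; last first.
      by apply: h; rewrite inE xA orbT.
    case/setU1P=> [->|]; last exact: h.
    split; last by case: (h x0 x0A).
    by apply: coreX; apply/coreP=> x' /h[].
  have /uniformP uA := clean_on_uniform p3 clA.
  have inX w : lvl w = same_level p.-1 -> (w \in X) = (w \in core A).
    move=> lw; rewrite eX inE; case: (boolP (w \in A)) => // /(subsetP sA).
    by rewrite inE lw => /eqP; rewrite /same_level; case: ifP; lia.
  apply/uniformP=> x x' w /setU1P xA /setU1P x'A lw xw.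
  have wA : w \in core A.
    case: xA => [e|xA]; last by apply/coreP=> x2 x2A; apply: (uA x).
    by rewrite -inX //; apply: sameX => //; rewrite -e.
  by case: x'A => [->|x'A]; [apply: coreX|apply: (coreP _ _ wA)].
- by rewrite eqcore eX setUA.
Qed.

(** For a new vertex with generating set [A], the clauses come from the size conditions of V*_p,
    completeness of the core, extensionality of sets, the definition of the core, uniformity of [A],
    and [new_level_max], in this order. *)
Lemma clean_factor_layered : layered (clean_factor H).
Proof.
have lp x : lvl x < p by [].
split.
- move=> [x|[X XN]] j /= x1 jx cond.
    have [y1 [y2 [y12 xy1 xy2 l1 l2]]] := layered_two HL x1 jx cond.
    by exists (inl y1), (inl y2); split.
  move: (XN); rewrite inE => /maxsetp/VstarP[A [sA A1 c1 clA eX]].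
  have [y1 [y2 [y1X y2X y12 l1 l2]]] : exists y1 y2,
      [/\ y1 \in X, y2 \in X, y1 != y2, lvl y1 = j & lvl y2 = j].
    (* Just below the new level the two neighbours are generators; on lower levels they are elements
       of the core. *)
    have [jp|jp] := eqVneq j p.-1.
      have /card_gt1P[y1 [y2 [y1A y2A y12]]] := A1.
      exists y1, y2; split; rewrite ?eX ?in_setU ?y1A ?y2A //.
        by move: (subsetP sA _ y1A); rewrite inE => /eqP->; lia.
      by move: (subsetP sA _ y2A); rewrite inE => /eqP->; lia.
    have /card_gt0P[x xA] := ltnW A1.
    have /card_gt1P[y1 [y2 [/core_inP y1A /core_inP y2A y12]]] :
        1 < #|\bigcap_(x in A) nbr_in j x| by apply: card_core_in => //; lia.
    exists y1, y2; split=> //; try by [case: (y1A x xA)|case: (y2A x xA)].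
      by rewrite eX in_setU orbC; apply/orP; left; apply/coreP=> x' /y1A[].
    by rewrite eX in_setU orbC; apply/orP; left; apply/coreP=> x' /y2A[].
  by exists (inl y1), (inl y2); split.
- move=> [x|[X XN]] [y|[Y YN]] [z|[Z ZN]] //= xy xz ly lz lyz; try by have := lp x; lia.
    exact: (layered_complete HL xy xz).
  move: XN xy xz; rewrite inE => /maxsetp/VstarP[A [sA A1 c1 clA ->]] /setUP[yA|yA] /setUP[zA|zA].
  + by case/negP: lyz; move: (subsetP sA _ yA) (subsetP sA _ zA); rewrite !inE => /eqP-> /eqP->.
  + exact: (coreP _ _ zA).
  + by rewrite adj_sym; apply: (coreP _ _ yA).
  + exact: core_complete sA (ltnW A1) yA zA lyz.
- move=> [x|[X XN]] [x'|[X' XN']] //= x1 lxx' h.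
  + by congr inl; apply: (layered_ext HL) => // y ly; apply: (h (inl y)).
  + by have := lp x; lia.
  + by have := lp x'; lia.
  + by congr inr; apply/val_inj/setP=> y; apply: (h (inl y) (lp y)).
- move=> [x|[X XN]] [w|[W WN]] //= lw h.
  + by apply: (layered_inter HL) lw _ => y ly xy; apply: (h (inl y)).
  + by have := lp x; lia.
  + move: XN h; rewrite inE => /maxsetp/VstarP[A [sA A1 c1 clA ->]] h.
    rewrite inE orbC; apply/orP; left; apply/coreP=> x xA; apply: (h (inl x)).
      by move: (subsetP sA _ xA); rewrite inE => /eqP /= ->; lia.
    by rewrite /= inE xA.
  + by lia.
- move=> x y y' w x3 xy xy' ly ly' lw.
  have [|sl _] := @same_level_lt (lvl x).-1; first by lia.
  rewrite -lw in sl; move: x y y' w x3 xy xy' ly ly' lw sl.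
  move=> [x|[X XN]] [y|[Y YN]] [y'|[Y' YN']] [w|[W WN]] //= x3 xy xy' ly ly' lw sl;
    try by [lia | have := lp x; lia].
    exact: (layered_same HL (x := x)).
  move: XN xy xy'; rewrite inE => /maxsetp/VstarP[A [sA A1 c1 clA eX]].
  have inA u : lvl u = p.-1 -> u \in X -> u \in A.
    move=> lu uX; rewrite -(biclique_top sA (ltnW A1)) -eX in_setI uX inE lu.
    by apply/eqP; lia.
  move=> yX y'X; apply: (uniformP _ _ (clean_on_uniform x3 clA) y y' w) => //.
    exact: inA.
  exact: inA.
- move=> [x|[X XN]] [y|[Y YN]] //= x1 ly low same.
  + apply: (layered_max HL) => // [w lw xw|x3 w lw yw].
      exact: (low (inl w)).
    exact: (same x3 (inl w)).
  + by have := lp x; lia.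
  + apply: new_level_max => // [w lw wX|p3 w lw yw].
      by apply: (low (inl w)) => //=; rewrite ly.
    by apply: (same p3 (inl w)) => //=; rewrite ly.
  + by lia.
Qed.
End CleanFactor.

(** No level exceeds 1, so every clause is vacuous. *)
Lemma layered2 (H : mpgraph 2) : layered H.
Proof.
have l1 (x : H) : lvl x <= 1 by rewrite -ltnS.
split; try by move=> x; have := l1 x; lia.
Qed.

(** * Counting vertices from the data of levels 0 and 1 *)

Section LowLevels.
Variables (n k c : nat).

Record low_bounds p (H : mpgraph p) : Prop := LowBounds {
  low_card : #|level H 0| = n;
  low_deg0 : forall v : H, lvl v = 0 -> 0 < #|nbr_in 1 v| <= k;
  low_deg1 : forall C : H, lvl C = 1 -> 0 < #|nbr_in 0 C| <= c
}.

(** The new level has index [p >= 2], so levels 0 and 1 and the edges between them stay the same. *)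
Lemma clean_factor_low_bounds p (H : mpgraph p) : 1 < p ->
  low_bounds H -> low_bounds (clean_factor H).
Proof.
move=> p1 [card0 deg0 deg1].
have inl_inj : injective (inl : H -> clean_factor H) by move=> x y [].
have nbrE j (x : H) : j < p ->
    #|nbr_in (H := clean_factor H) j (inl x)| = #|nbr_in j x|.
  move=> jp; rewrite -(card_imset _ inl_inj); apply: eq_card => -[y|Y].
    by rewrite (mem_imset _ _ inl_inj) !inE.
  rewrite !inE /= gtn_eqF // andbF; apply/esym/negbTE/negP.
  by case/imsetP.
split.
- rewrite -card0 -(card_imset _ inl_inj); apply: eq_card => -[y|Y].
    by rewrite (mem_imset _ _ inl_inj) !inE.
  rewrite !inE /= gtn_eqF //; last by lia.
  by apply/esym/negbTE/negP => /imsetP[].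
- by move=> [v|V] /= lv; [rewrite nbrE; [exact: deg0 | lia] | lia].
- by move=> [C|C] /= lC; [rewrite nbrE; [exact: deg1 | lia] | lia].
Qed.

Section Bounds.
Variables (p : nat) (H : mpgraph p).
Hypotheses (HL : layered H) (HB : low_bounds H).

Lemma nbr_in_gt0P j (x : H) :
  reflect (exists2 y, adj x y & lvl y = j) (0 < #|nbr_in j x|).
Proof.
apply: (iffP card_gt0P) => -[y].
  by rewrite !inE => /andP[xy /eqP]; exists y.
by move=> xy ly; exists y; rewrite !inE xy ly eqxx.
Qed.

Lemma chain_fam_chains (x v : H) : 1 < lvl x -> lvl v = 0 -> adj x v ->
  chain_fam x \in chains (nbr_in 1 v).
Proof.
move=> x1 lv xv; apply/chainsP; split=> [A AF|A AF|A B].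
- apply/subsetP=> C /(subsetP (chain_fam_common0 HL x1 AF))/commonP[lC aC].
  by rewrite !inE lC eqxx andbT; apply: aC.
- have [C xC lC] := some_nbr HL x1 x1.
  by apply/set0Pn; exists C; apply: (nbr_chain_fam HL x1 AF).
- exact: chain_fam_comparable.
Qed.

Lemma dual_fam_chains (x C : H) : 1 < lvl x -> lvl C = 1 -> adj x C ->
  dual_fam x \in chains (nbr_in 0 C).
Proof.
move=> x1 lC xC; apply/chainsP; split=> [_ /imsetP[A AF ->]|B BF|].
- apply/subsetP=> v /dualP[lv vA]; rewrite !inE lv eqxx andbT adj_sym.
  by apply: vA; apply: (nbr_chain_fam HL x1 AF).
- have [v xv lv] := some_nbr HL x1 (ltnW x1).
  by apply/set0Pn; exists v; apply: (nbr_dual_fam HL x1 BF).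
- move=> _ _ /imsetP[A AF ->] /imsetP[B BF ->].
  by case/orP: (chain_fam_comparable HL x1 AF BF) => /dualS->; rewrite ?orbT.
Qed.

(** The default [x] is returned only when [x] has no neighbour on level [j], a case that [pick_nbrP]
    excludes. *)
Definition pick_nbr j (x : H) : H := odflt x [pick y in nbr_in j x].

Lemma pick_nbrP j (x : H) : (exists2 y, adj x y & lvl y = j) ->
  adj x (pick_nbr j x) /\ lvl (pick_nbr j x) = j.
Proof.
rewrite /pick_nbr; case: pickP => [y + _|no [y xy ly]] /=.
  by rewrite !inE => /andP[-> /eqP].
by have := no y; rewrite !inE xy ly eqxx.
Qed.

(** Level 0 is counted apart and gives the summand [n]. Any other vertex is encoded by a neighbour
    [v] on level 0 and a chain of sets of cliques adjacent to [v]; a clique on level 1 gets the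
    chain made of its own singleton. *)
Lemma card_le_deg0 : #|{: H}| <= (2 ^ k * k`! + 1) * n.
Proof.
pose F (x : H) := if lvl x == 1 then [set [set x]] else chain_fam x.
rewrite -(cardsT H) -(setUCr (level H 0)).
apply: leq_trans (leq_card_setU _ _) _; rewrite (low_card HB).
rewrite mulnDl mul1n addnC leq_add2r mulnC -(low_card HB).
apply: (card_le_chains (N := nbr_in 1) (r := pick_nbr 0) (F := F)).
- by move=> v; rewrite inE => /eqP /(low_deg0 HB) /andP[].
- move=> x; rewrite in_setC [x \in _]inE => x0.
  have [] := @pick_nbrP 0 x.
    have [x1|x1] := eqVneq (lvl x) 1; last by apply: (some_nbr HL); lia.
    by apply/nbr_in_gt0P; case/andP: (low_deg1 HB x1).
  set v := pick_nbr 0 x => xv lv; split; first by rewrite inE lv.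
  rewrite /F; case: eqVneq => [x1|x1]; last by apply: chain_fam_chains => //; lia.
  apply/chainsP; split=> [A /set1P->|A /set1P->|A B /set1P-> /set1P->].
  + by rewrite sub1set !inE adj_sym xv x1.
  + by apply/set0Pn; exists x; rewrite set11.
  + by rewrite subxx.
(* A vertex above level 1 has two neighbours on level 1, so no set of its chain is a singleton. *)
have diff (x y : H) : lvl x = 1 -> 1 < lvl y -> [set [set x]] = chain_fam y -> x = y.
  move=> x1 y1 eqF; have xF : [set x] \in chain_fam y by rewrite -eqF set11.
  have [C1 [C2 [/eqP C12 yC1 yC2 l1 l2]]] := two_nbrs HL y1 y1.
  case: C12.
  have /set1P-> := nbr_chain_fam HL y1 xF l1 yC1.
  by have /set1P-> := nbr_chain_fam HL y1 xF l2 yC2.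
move=> x y; rewrite !inE /F => x0 y0 _.
case: eqVneq => [x1|x1]; case: eqVneq => [y1|y1] e.
- exact: set1_inj (set1_inj e).
- by apply: diff e => //; lia.
- by apply/esym; apply: diff (esym e) => //; lia.
- by apply: (chain_fam_inj HL) e; lia.
Qed.

Lemma card_level1 : #|level H 1| <= k * n.
Proof.
have sub : level H 1 \subset \bigcup_(v in level H 0) nbr_in 1 v.
  apply/subsetP=> C; rewrite inE => /eqP lC.
  have /nbr_in_gt0P[v Cv lv] : 0 < #|nbr_in 0 C| by case/andP: (low_deg1 HB lC).
  by apply/bigcupP; exists v; rewrite !inE ?lv // adj_sym Cv lC.
rewrite mulnC -(low_card HB); apply: leq_trans (subset_leq_card sub) _.
by apply: card_bigcup_le => v; rewrite inE => /eqP /(low_deg0 HB) /andP[].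
Qed.

(** Here the base points are the at most [k * n] cliques of level 1. A clique is its own base point
    with the empty chain, a vertex of level 0 gets its own singleton, and higher vertices get their
    dual chain. *)
Lemma card_le_deg1 : #|{: H}| <= k * 2 ^ c * c`! * n.
Proof.
pose F (x : H) :=
  if lvl x == 1 then set0 else if lvl x == 0 then [set [set x]] else dual_fam x.
pose r (x : H) := if lvl x == 1 then x else pick_nbr 1 x.
apply: (@leq_trans (#|level H 1| * (2 ^ c * c`!))); last first.
  have := card_level1; rewrite -(leq_pmul2r (m := 2 ^ c * c`!)); first by lia.
  by rewrite muln_gt0 expn_gt0 fact_gt0.
rewrite -(cardsT H); apply: (card_le_chains (N := nbr_in 0) (r := r) (F := F)).
- by move=> C; rewrite inE => /eqP /(low_deg1 HB) /andP[].
- move=> x _; rewrite /r /F; have [x1|x1] := eqVneq (lvl x) 1.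
    by split; [rewrite inE x1 | apply/chainsP; split=> A; rewrite inE].
  have [] := @pick_nbrP 1 x.
    have [x0|x0] := eqVneq (lvl x) 0; last by apply: (some_nbr HL); lia.
    by apply/nbr_in_gt0P; case/andP: (low_deg0 HB x0).
  set C := pick_nbr 1 x => xC lC; split; first by rewrite inE lC.
  case: eqVneq => [x0|x0]; last by apply: dual_fam_chains => //; lia.
  apply/chainsP; split=> [A /set1P->|A /set1P->|A B /set1P-> /set1P->].
  + by rewrite sub1set !inE adj_sym xC x0.
  + by apply/set0Pn; exists x; rewrite set11.
  + by rewrite subxx.
(* Every set of a dual chain contains the at least two neighbours on level 0, so it is not a
   singleton. *)
have diff (x y : H) : lvl x = 0 -> 1 < lvl y -> [set [set x]] = dual_fam y -> x = y.
  move=> x0 y1 eqF; have xF : [set x] \in dual_fam y by rewrite -eqF set11.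
  have [v1 [v2 [/eqP v12 yv1 yv2 l1 l2]]] := two_nbrs HL y1 (ltnW y1).
  case: v12.
  have /set1P-> := nbr_dual_fam HL y1 xF l1 yv1.
  by have /set1P-> := nbr_dual_fam HL y1 xF l2 yv2.
(* Non-emptiness separates the other vertices from the cliques of level 1, which alone have the
   empty chain. *)
have F_neq0 (x : H) : lvl x != 1 -> F x != set0.
  rewrite /F => x1; rewrite (negbTE x1); have [x0|x0] := eqVneq (lvl x) 0; apply/set0Pn.
    by exists [set x]; rewrite set11.
  exists (dual (common 0 x)); apply: imset_f; apply/chain_famP; exists 0 => //; lia.
move=> x y _ _; rewrite /r.
have [x1|x1] := eqVneq (lvl x) 1; have [y1|y1] := eqVneq (lvl y) 1 => //.
- by move=> _ e; case/negP: (F_neq0 y y1); rewrite -e /F x1 eqxx.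
- by move=> _ e; case/negP: (F_neq0 x x1); rewrite e /F y1 eqxx.
move=> _; rewrite /F (negbTE x1) (negbTE y1).
case: eqVneq => [x0|x0]; case: eqVneq => [y0|y0] e.
- exact: set1_inj (set1_inj e).
- by apply: diff e => //; lia.
- by apply/esym; apply: diff (esym e) => //; lia.
- by apply: (dual_fam_inj HL) e; lia.
Qed.

End Bounds.
End LowLevels.

(** * The incidence graph and the final bound *)

Lemma incidence_low_bounds (T : finType) (e : rel T) (k c : nat) :
  (forall v : T, #|[set C in max_cliques e | v \in C]| <= k) ->
  (forall C : {set T}, C \in max_cliques e -> #|C| <= c) ->
  low_bounds #|T| k c (incidence e).
Proof.
move=> hk hc.
have inl_inj : injective (inl : T -> incidence e) by move=> x y [].
have inr_inj : injective (inr : {C | C \in max_cliques e} -> incidence e) by move=> x y [].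
split.
- rewrite -cardsT -(card_imset _ inl_inj); apply: eq_card => -[y|Y].
    by rewrite (mem_imset _ _ inl_inj) !inE.
  by rewrite !inE /=; apply/esym/negbTE/negP => /imsetP[].
- move=> [v|//] _; apply/andP; split.
    (* Lower bound on the degree: the clique [[set v]] extends to a maximal one. *)
    have clv : clique e [set v].
      apply/andP; split; first by apply/set0Pn; exists v; rewrite set11.
      by apply/forall_inP=> y /set1P->; apply/forall_inP=> z /set1P->; rewrite eqxx.
    have [C maxC vC] := maxset_exists clv.
    have CP : C \in max_cliques e by rewrite inE.
    apply/card_gt0P; exists (inr (exist _ C CP)); rewrite !inE /= andbT.
    by rewrite -sub1set.
  apply: leq_trans (hk v).
  have sub : nbr_in (H := incidence e) 1 (inl v) \subset
      [set inr D | D : {C | C \in max_cliques e} & v \in val D].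
    apply/subsetP=> -[y|[C CP]]; rewrite !inE //= andbT => vC.
    by apply/imsetP; exists (exist _ C CP); rewrite ?inE.
  apply: leq_trans (subset_leq_card sub) _; apply: leq_trans (leq_imset_card _ _) _.
  rewrite -(card_imset _ val_inj); apply: subset_leq_card.
  apply/subsetP=> _ /imsetP[[C CP] /= + ->]; rewrite inE /= => vC.
  by rewrite inE CP.
- move=> [//|[C CP]] _; apply/andP; split.
    have : C != set0 by move: CP; rewrite inE => /maxsetp/andP[].
    case/set0Pn=> v vC; apply/card_gt0P; exists (inl v).
    by rewrite !inE /= vC.
  apply: leq_trans (hc C CP).
  have sub : nbr_in (H := incidence e) 0 (inr (exist _ C CP)) \subset [set inl v | v in C].
    apply/subsetP=> -[y|D]; rewrite !inE //= andbT => yC.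
    by apply/imsetP; exists y.
  exact: leq_trans (subset_leq_card sub) (leq_imset_card _ _).
Qed.

Theorem theorem3 (T : finType) (e : rel T)
    (e_sym : symmetric e) (e_irr : irreflexive e)
    (k c : nat)
    (hk : forall v : T, #|[set C in max_cliques e | v \in C]| <= k)
    (hc : forall C : {set T}, C \in max_cliques e -> #|C| <= c)
    (i : nat) (M : mpgraph i.+2) (hM : series_ends_on e M) :
  #|{: M}| <= minn (k * 2 ^ c * c`!) (2 ^ k * k`! + 1) * #|T|.
Proof.
have [ML MB] : layered M /\ low_bounds #|T| k c M.
  case: hM => + _; elim: i M => [|i IHi] M /=.
    by case=> <-; split; [exact: layered2 | exact: incidence_low_bounds].
  case: (clean_series e i) IHi => [H|//] IHi; case: ifP => // _ [<-].
  have [HL HB] := IHi H (erefl _).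
  by split; [exact: clean_factor_layered | exact: clean_factor_low_bounds].
by rewrite minnMl leq_min (card_le_deg1 ML MB) (card_le_deg0 ML MB).
Qed.
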